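(* As formal power series in $q$ with coefficients Laurent polynomials in $z$, \[ (1-z)(1-z^{-1})\,\overline{S}(z,q)=\sum_{n=0}^\infty\sum_{m=-\infty}^\infty\bigl(\overline{N}(m,n)-\overline{M}(m,n)\bigr)z^mq^n . \]
   Context: Notation: $(a;q)_\infty=\prod_{k\ge0}(1-aq^k)$, $(a;q)_n=(a;q)_\infty/(aq^n;q)_\infty$, and $(a_1,\dots,a_j;q)_n=(a_1;q)_n\cdots(a_j;q)_n$ (also for $n=\infty$). Define \[ \overline{S}(z,q)=\sum_{n=1}^\infty\frac{q^n(-q^{n+1};q)_\infty(q^{n+1};q)_\infty}{(zq^n;q)_\infty(z^{-1}q^n;q)_\infty}. \] The numbers $\overline{N}(m,n)$ (number of overpartitions of $n$ with Dyson rank $m$, the rank being largest part minus number of parts) are defined by \[ \sum_{n\ge0}\sum_{m}\overline{N}(m,n)z^mq^n=\sum_{n=0}^\infty\frac{(-1;q)_n\,q^{n(n+1)/2}}{(zq;q)_n(z^{-1}q;q)_n}, \] and the numbers $\overline{M}(m,n)$ (a residual crank count for overpartitions) are defined by \[ \sum_{n\ge0}\sum_{m}\overline{M}(m,n)z^mq^n=\frac{(-q;q)_\infty(q;q)_\infty}{(zq;q)_\infty(z^{-1}q;q)_\infty}. \] *)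

(* Defs.v *)
(* Formal power series in q with coefficients in the field
   of fractions of Z[z]; this field contains the Laurent polynomials Z[z,z^-1]. *)
From mathcomp Require Import all_boot all_order all_algebra fraction.
Set Implicit Arguments. Unset Strict Implicit. Unset Printing Implicit Defensive.
Import Order.TTheory GRing.Theory Num.Theory.
Local Open Scope ring_scope.

Definition K : fieldType := {fraction {poly int}}.
Definition z : K := @FracField.tofrac _ ('X : {poly int}).

Definition fps := nat -> K.

Definition fps_c (c : K) : fps := fun n => if n == 0%N then c else 0.
Definition fps_qpow (k : nat) : fps := fun n => if n == k then 1 else 0.
Definition fps_add (f g : fps) : fps := fun n => f n + g n.
Definition fps_sub (f g : fps) : fps := fun n => f n - g n.
Definition fps_mul (f g : fps) : fps := fun n => \sum_(i < n.+1) f i * g (n - i)%N.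

Fixpoint fps_inv_seq (f : fps) (n : nat) : seq K :=
  match n with
  | 0 => [:: (f 0%N)^-1]
  | n'.+1 => let s := fps_inv_seq f n' in
      rcons s (- (f 0%N)^-1 * \sum_(i < n'.+1) f i.+1 * nth 0 s (n' - i)%N)
  end.
Definition fps_inv (f : fps) : fps := fun n => nth 0 (fps_inv_seq f n) n.

Definition qpoch (a : fps) (n : nat) : fps :=
  \big[fps_mul/fps_c 1]_(k < n) fps_sub (fps_c 1) (fps_mul a (fps_qpow k)).

(* infinite q-Pochhammer (a;q)_oo, for a with zero constant term (the q-adic
   limit): the factors with k >= N only affect coefficients of q^{>N}, so the
   coefficient of q^N equals that of (a;q)_{N+1}. *)
Definition qpoch_inf (a : fps) : fps := fun N => qpoch a N.+1 N.

(* infinite sum sum_{n >= m} T n, for families with T n = O(q^n) (q-adic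
   limit): the coefficient of q^N only receives contributions from n <= N. *)
Definition fps_series_from (m : nat) (T : nat -> fps) : fps :=
  fun N => \sum_(m <= n < N.+1) T n N.

Definition cq (c : K) (k : nat) : fps := fps_mul (fps_c c) (fps_qpow k).

Definition Sbar : fps :=
  fps_series_from 1 (fun n =>
    fps_mul (fps_qpow n)
    (fps_mul (qpoch_inf (cq (-1) n.+1))
    (fps_mul (qpoch_inf (cq 1 n.+1))
    (fps_mul (fps_inv (qpoch_inf (cq z n)))
             (fps_inv (qpoch_inf (cq z^-1 n))))))).

Definition NbarGF : fps :=
  fps_series_from 0 (fun n =>
    fps_mul (qpoch (fps_c (-1)) n)
    (fps_mul (fps_qpow (n * n.+1)./2)
    (fps_mul (fps_inv (qpoch (cq z 1) n))
             (fps_inv (qpoch (cq z^-1 1) n))))).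

Definition MbarGF : fps :=
  fps_mul (qpoch_inf (cq (-1) 1))
  (fps_mul (qpoch_inf (cq 1 1))
  (fps_mul (fps_inv (qpoch_inf (cq z 1)))
           (fps_inv (qpoch_inf (cq z^-1 1))))).

(* Main.v *)
(* Put phi(b; x, y) = (q)_oo (-bq)_oo sum_n (x)_n (y)_n q^n / ((q)_n (-bq)_n).
   The partial sums telescope and give, for all b, x, y,
     phi(b; x, y) = (xq)_oo (yq)_oo + (b + xy) q phi(bq; xq, yq).
   If xy = bc then b + xy = b (1 + c), and iterating yields
     phi(b; x, y) = sum_j (-c)_j b^j q^(j(j+1)/2) (x q^(j+1))_oo (y q^(j+1))_oo,
   a limiting case of a 3phi2 transformation.  For b = c = 1,
   x = z, y = 1/z, dividing by (zq)_oo (q/z)_oo turns the right-hand side into the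
   rank generating function; on the left the term n = 0 is the crank generating
   function and the terms n >= 1 are (1 - z)(1 - 1/z) Sbar. *)
Require Import Defs.
From HB Require Import structures.
From mathcomp Require Import all_boot all_order all_algebra.
From mathcomp Require Import boolp ring.
Import GRing.Theory.
Local Open Scope ring_scope.

(** * The commutative ring of formal power series *)

Definition fps_trunc (d : nat) (f : fps) : {poly K} := \poly_(i < d) f i.

(** A coefficient of a Cauchy product involves only coefficients of lower or equal index, so the
    ring laws can be read off from [{poly K}]. *)
Lemma fps_mul_trunc (d : nat) (f g : fps) (i : nat) :
  (i < d)%N -> fps_mul f g i = (fps_trunc d f * fps_trunc d g)`_i.
Proof.
move=> lid; rewrite coefM; apply: eq_bigr => j _.
rewrite !coef_poly (leq_ltn_trans (leq_subr _ _) lid).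
by rewrite (leq_ltn_trans _ lid) // -ltnS.
Qed.

Lemma fps_trunc_mul (d : nat) (f g : fps) (i : nat) :
  (i < d)%N -> (fps_trunc d (fps_mul f g))`_i = (fps_trunc d f * fps_trunc d g)`_i.
Proof. by move=> lid; rewrite coef_poly lid (fps_mul_trunc d). Qed.

Lemma fps_mulC : commutative fps_mul.
Proof.
by move=> f g; apply/funext => i; rewrite !(fps_mul_trunc i.+1) // mulrC.
Qed.

Lemma fps_mulA : associative fps_mul.
Proof.
move=> f g h; apply/funext => i; rewrite !(fps_mul_trunc i.+1) //.
(* The truncation of a product and the product of truncations differ, but only from degree [i.+1]
   on; hence the comparison under [coefM]. *)
transitivity (fps_trunc i.+1 f * (fps_trunc i.+1 g * fps_trunc i.+1 h))`_i.
  by rewrite !coefM; apply: eq_bigr => j _; rewrite fps_trunc_mul // ltnS leq_subr.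
by rewrite mulrA !coefM; apply: eq_bigr => j _; rewrite fps_trunc_mul.
Qed.

Lemma fps_addA : associative fps_add.
Proof. by move=> f g h; apply/funext => i; rewrite /fps_add addrA. Qed.

Lemma fps_addC : commutative fps_add.
Proof. by move=> f g; apply/funext => i; rewrite /fps_add addrC. Qed.

Lemma fps_add0 : left_id (fps_c 0) fps_add.
Proof. by move=> f; apply/funext => i; rewrite /fps_add /fps_c if_same add0r. Qed.

Definition fps_opp (f : fps) : fps := fun n => - f n.

Lemma fps_addN : left_inverse (fps_c 0) fps_opp fps_add.
Proof.
by move=> f; apply/funext => i; rewrite /fps_add /fps_opp /fps_c if_same addNr.
Qed.

Lemma fps_cM (c : K) (f : fps) (i : nat) : fps_mul (fps_c c) f i = c * f i.
Proof.
rewrite /fps_mul big_ord_recl big1 ?addr0 ?subn0 // => j _.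
by rewrite /fps_c /= mul0r.
Qed.

Lemma fps_mul1 : left_id (fps_c 1) fps_mul.
Proof. by move=> f; apply/funext => i; rewrite fps_cM mul1r. Qed.

Lemma fps_mulDl : left_distributive fps_mul fps_add.
Proof.
move=> f g h; apply/funext => i; rewrite /fps_add /fps_mul -big_split /=.
by apply: eq_bigr => j _; rewrite mulrDl.
Qed.


(** Equality of functions is not decidable; classical axioms supply the equality and choice
    structures required below a ring. *)
HB.instance Definition _ := gen_eqMixin fps.
HB.instance Definition _ := gen_choiceMixin fps.
HB.instance Definition _ :=
  GRing.isZmodule.Build fps fps_addA fps_addC fps_add0 fps_addN.

Lemma fps_1neq0 : fps_c 1 != 0 :> fps.
Proof.
apply/eqP => /(congr1 (fun f : fps => f 0%N)) /eqP.
by rewrite /fps_c /= oner_eq0.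
Qed.

HB.instance Definition _ :=
  GRing.Zmodule_isComNzRing.Build fps fps_mulA fps_mulC fps_mul1 fps_mulDl fps_1neq0.

(** * Coefficients, powers of [q] and inverses *)

Local Notation q := (fps_qpow 1 : fps).

Lemma fps_mul_coef0 (f g : fps) : (f * g) 0%N = f 0%N * g 0%N.
Proof. by rewrite /GRing.mul /= /fps_mul big_ord1. Qed.

Lemma fps_sum_coef (I : Type) (r : seq I) (P : pred I) (F : I -> fps) (i : nat) :
  (\sum_(j <- r | P j) F j) i = \sum_(j <- r | P j) F j i.
Proof.
by apply: (big_morph (fun f : fps => f i)) => //; rewrite /GRing.zero /= /fps_c if_same.
Qed.

Lemma fps_cMm (c d : K) : fps_c (c * d) = (fps_c c : fps) * fps_c d.
Proof.
apply/funext => i; rewrite [RHS]fps_cM /fps_c.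
by case: (i == _); rewrite ?mulr0.
Qed.

Lemma fps_cB (c d : K) : fps_c (c - d) = (fps_c c : fps) - fps_c d.
Proof.
apply/funext => i; rewrite /GRing.add /GRing.opp /= /fps_add /fps_opp /fps_c.
by case: (i == _); rewrite ?subr0.
Qed.

Lemma fps_qpowM_coef (k : nat) (f : fps) (i : nat) :
  ((fps_qpow k : fps) * f) i = if (k <= i)%N then f (i - k)%N else 0.
Proof.
rewrite /GRing.mul /= /fps_mul /fps_qpow; case: leqP => [le_ki | lt_ik].
  rewrite (bigD1 (inord k)) //= inordK ?ltnS // eqxx mul1r big1 ?addr0 // => j.
  by rewrite -val_eqE /= inordK ?ltnS // => /negPf ->; rewrite mul0r.
rewrite big1 // => j _; case: eqP => [jk|_]; last by rewrite mul0r.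
by have := ltn_ord j; rewrite jk ltnS leqNgt lt_ik.
Qed.

Lemma fps_qpowE (k : nat) : fps_qpow k = q ^+ k.
Proof.
elim: k => [|k IHk]; first by rewrite expr0.
rewrite exprS -IHk; apply/funext => i; rewrite fps_qpowM_coef /fps_qpow.
by case: i => [|i] //=; rewrite subn1.
Qed.

Lemma cqE (c : K) (k : nat) : cq c k = (fps_c c : fps) * q ^+ k.
Proof. by rewrite -fps_qpowE. Qed.

Lemma fps_inv_seq_size (f : fps) (n : nat) : size (fps_inv_seq f n) = n.+1.
Proof. by elim: n => //= n IHn; rewrite size_rcons IHn. Qed.

(** The recursion only appends, so entries already computed never change. *)
Lemma fps_inv_seq_nth (f : fps) (n i : nat) :
  (i <= n)%N -> nth 0 (fps_inv_seq f n) i = fps_inv f i.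
Proof.
elim: n => [|n IHn]; first by case: i.
rewrite leq_eqVlt => /predU1P[-> //|lt_in].
by rewrite /= nth_rcons fps_inv_seq_size lt_in IHn.
Qed.

Lemma fps_mulV {f : fps} : f 0%N != 0 -> f * fps_inv f = 1.
Proof.
move=> f0; apply/funext => -[|n]; first by rewrite fps_mul_coef0 mulfV.
rewrite /GRing.mul /= /fps_mul big_ord_recl /= subn0.
rewrite {1}/fps_inv /= nth_rcons fps_inv_seq_size ltnn eqxx mulrA mulrN mulfV //.
rewrite mulN1r; apply/eqP; rewrite addrC subr_eq0; apply/eqP.
by apply: eq_bigr => i _; rewrite subSS fps_inv_seq_nth // leq_subr.
Qed.

Lemma fps_mulfI {f g h : fps} : f 0%N != 0 -> f * g = f * h -> g = h.
Proof.
move=> f0 e; rewrite -[g]mul1r -[h]mul1r -(fps_mulV f0).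
by rewrite ![f * _]mulrC -!mulrA e.
Qed.

(** * Congruence modulo powers of [q], and infinite sums *)

(** Congruence modulo [q ^+ d]. It replaces limits: by [eqmP], an identity may be checked modulo
    every power of [q]. *)
Definition eqm (d : nat) (f g : fps) : Prop := forall i, (i < d)%N -> f i = g i.

Lemma eqm_refl f {d} : eqm d f f. Proof. by []. Qed.

Lemma eqm_sym {d f g} : eqm d f g -> eqm d g f.
Proof. by move=> fg i /fg ->. Qed.

Lemma eqm_trans {d f g h} : eqm d f g -> eqm d g h -> eqm d f h.
Proof. by move=> fg gh i lid; rewrite fg // gh. Qed.

Lemma eqm_le {d e f g} : (d <= e)%N -> eqm e f g -> eqm d f g.
Proof. by move=> de fg i lid; rewrite fg // (leq_trans lid). Qed.

Lemma eqmD {d} {f f' g g' : fps} : eqm d f f' -> eqm d g g' -> eqm d (f + g) (f' + g').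
Proof. by move=> ff gg i lid; rewrite /GRing.add /= /fps_add ff ?gg. Qed.

Lemma eqmN {d} {f f' : fps} : eqm d f f' -> eqm d (- f) (- f').
Proof. by move=> ff i lid; rewrite /GRing.opp /= /fps_opp ff. Qed.

Lemma eqmM {d} {f f' g g' : fps} : eqm d f f' -> eqm d g g' -> eqm d (f * g) (f' * g').
Proof.
move=> ff gg i lid; apply: eq_bigr => j _.
by rewrite ff ?gg ?(leq_ltn_trans (leq_subr _ _) lid) // (leq_ltn_trans _ lid) // -ltnS.
Qed.

Lemma eqmP (f g : fps) : (forall d, eqm d f g) -> f = g.
Proof. by move=> fg; apply/funext => i; exact: (fg i.+1). Qed.

Lemma eqm_qX {d k : nat} (f : fps) : (d <= k)%N -> eqm d (q ^+ k * f) 0.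
Proof.
move=> dk i lid; rewrite -fps_qpowE fps_qpowM_coef leqNgt (leq_trans lid dk) /=.
by rewrite /GRing.zero /= /fps_c if_same.
Qed.

Lemma series_eqm {d} (m : nat) {T : nat -> fps} : (forall n, eqm n (T n) 0) ->
  eqm d (fps_series_from m T) (\sum_(m <= n < d) T n).
Proof.
move=> T0 i lid; rewrite fps_sum_coef /fps_series_from !big_geq_mkord.
rewrite (big_ord_widen_cond _ (fun n => m <= n)%N (fun n => T n i) lid) big_mkcondr /=.
apply: eq_bigr => n _; case: ltnP => // lt_in.
by rewrite T0 // /GRing.zero /= /fps_c if_same.
Qed.

(** Multiplication by [g] keeps the n-th term divisible by [q ^+ n], so both sides reduce to the
    same finite sum modulo [q ^+ d]. *)
Lemma mul_series (m : nat) (g : fps) {T : nat -> fps} : (forall n, eqm n (T n) 0) ->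
  g * fps_series_from m T = fps_series_from m (fun n => g * T n).
Proof.
move=> T0; apply: eqmP => d.
apply: eqm_trans (eqmM (eqm_refl g) (series_eqm m T0)) _.
rewrite mulr_sumr; apply/eqm_sym/series_eqm => n.
by rewrite -(mulr0 g); apply: eqmM.
Qed.

Lemma eq_series {m : nat} {T T' : nat -> fps} :
  (forall n, (m <= n)%N -> T n = T' n) -> fps_series_from m T = fps_series_from m T'.
Proof.
move=> TT; apply/funext => i; apply: eq_big_nat => n /andP[mn _].
by rewrite TT.
Qed.

Lemma series_recl (T : nat -> fps) :
  fps_series_from 0 T = T 0%N + fps_series_from 1 T.
Proof. by apply/funext => i; rewrite /fps_series_from big_ltn. Qed.

(** * Finite and infinite q-Pochhammer symbols *)

Lemma qpochE (a : fps) (n : nat) : qpoch a n = \prod_(k < n) (1 - a * q ^+ k).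
Proof. by apply: eq_bigr => k _; rewrite -fps_qpowE. Qed.

Lemma qpoch0 (a : fps) : qpoch a 0 = 1.
Proof. by rewrite qpochE big_ord0. Qed.

Lemma qpochS (a : fps) (n : nat) : qpoch a n.+1 = qpoch a n * (1 - a * q ^+ n).
Proof. by rewrite !qpochE big_ord_recr. Qed.

Lemma qpochSl (a : fps) (n : nat) : qpoch a n.+1 = (1 - a) * qpoch (a * q) n.
Proof.
rewrite !qpochE big_ord_recl expr0 mulr1; congr (_ * _).
by apply: eq_bigr => k _; rewrite /= exprS mulrA.
Qed.

(* No condition on [a 0%N]: the factor [1 - a * q ^+ k] is [1] modulo [q ^+ k]. *)
Lemma qpoch_inf_eqm (a : fps) {d n : nat} :
  (d <= n)%N -> eqm d (qpoch_inf a) (qpoch a n).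
Proof.
move=> dn i lid; rewrite /qpoch_inf.
have : (i.+1 <= n)%N := leq_trans lid dn.
elim: n {dn} => // n IHn; rewrite leq_eqVlt => /predU1P[-> //|lin].
have -> : qpoch a n.+1 = qpoch a n + - (q ^+ n * (qpoch a n * a)) by rewrite qpochS; ring.
rewrite IHn //.
have lin' : (i < n)%N := lin.
by rewrite (eqmD (eqm_refl _) (eqmN (eqm_qX _ lin')) i (ltnSn i)) oppr0 addr0.
Qed.

Lemma qpoch_inf_cat (a : fps) (n : nat) :
  qpoch_inf a = qpoch a n * qpoch_inf (a * q ^+ n).
Proof.
elim: n => [|n ->]; first by rewrite qpoch0 expr0 mulr1 mul1r.
rewrite qpochS -[RHS]mulrA exprSr (mulrA a); congr (_ * _); apply: eqmP => d.
(* One factor more than the precision [d] requires: splitting off the first leaves exactly [d]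
   factors for the right-hand side. *)
apply: eqm_trans (qpoch_inf_eqm _ (leqnSn d)) _; rewrite qpochSl.
by apply: eqmM => //; apply/eqm_sym/qpoch_inf_eqm.
Qed.

Lemma qpoch_infS (a : fps) : qpoch_inf a = (1 - a) * qpoch_inf (a * q).
Proof. by rewrite (qpoch_inf_cat a 1) qpochSl qpoch0 mulr1 expr1. Qed.

Lemma qpoch_inf_eqm1 (a : fps) (n : nat) : eqm n (qpoch_inf (a * q ^+ n)) 1.
Proof.
apply: eqm_trans (qpoch_inf_eqm _ (leqnn n)) _.
rewrite qpochE; elim/big_ind: _ => // [f g f1 g1|k _].
  by rewrite -(mulr1 1); apply: eqmM.
have -> : 1 - a * q ^+ n * q ^+ k = 1 + - (q ^+ n * (a * q ^+ k)) by ring.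
rewrite -[X in eqm _ _ X]subr0; apply: eqmD => //; apply: eqmN.
exact: eqm_qX.
Qed.

Lemma qpoch_inf_coef0 (a : fps) : a 0%N = 0 -> qpoch_inf a 0%N != 0.
Proof.
move=> a0; rewrite /qpoch_inf qpochSl qpoch0 mulr1.
by rewrite /GRing.add /GRing.opp /= /fps_add /fps_opp a0 subr0 /GRing.one /= /fps_c oner_eq0.
Qed.

(** * The series [phi] and its transformation *)

(* Multiplied through by (q)_oo (-bq)_oo, so that no inverse occurs. *)
Definition phi_term (b x y : fps) (n : nat) : fps :=
  q ^+ n * (qpoch_inf (q ^+ n.+1) * qpoch_inf (- b * q ^+ n.+1) * (qpoch x n * qpoch y n)).

Definition phi (b x y : fps) : fps := fps_series_from 0 (phi_term b x y).

Lemma phi_term_eqm b x y n : eqm n (phi_term b x y n) 0.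
Proof. exact: eqm_qX. Qed.

(** With [t = q ^+ N.+1], the induction step is a common factor times the identity [(1 - t)(1 + b t)
    + t (1 - x)(1 - y) = (1 - x t)(1 - y t) + (b + x y) t (1 - t)]. *)
Lemma phi_telescope (b x y : fps) (N : nat) :
  \sum_(0 <= n < N.+1) phi_term b x y n =
  qpoch_inf (q ^+ N.+1) * qpoch_inf (- b * q ^+ N.+1) * (qpoch (x * q) N * qpoch (y * q) N)
  + (b + x * y) * q * \sum_(0 <= n < N) phi_term (b * q) (x * q) (y * q) n.
Proof.
elim: N => [|N IHN].
  by rewrite big_nat1 big_geq // /phi_term !qpoch0; ring.
rewrite big_nat_recr //= IHN [in RHS]big_nat_recr //= /phi_term.
have -> : - (b * q) * q ^+ N.+1 = - b * q ^+ N.+2 by rewrite (exprS _ N.+1); ring.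
rewrite !(qpochSl x) !(qpochSl y) (qpochS (x * q)) (qpochS (y * q)).
rewrite (qpoch_infS (q ^+ N.+1)) (qpoch_infS (- b * q ^+ N.+1)).
rewrite -(mulrA (- b)) -(exprSr _ N.+1) !(exprS _ N).
set S := \sum_(0 <= n < N) _; set E := qpoch_inf (q ^+ N.+2).
set F := qpoch_inf _; set U := qpoch _ _; set V := qpoch _ _.
ring.
Qed.

Lemma phi_rec (b x y : fps) :
  phi b x y = qpoch_inf (x * q) * qpoch_inf (y * q)
              + (b + x * y) * q * phi (b * q) (x * q) (y * q).
Proof.
apply: eqmP => d.
have lhs : eqm d (phi b x y) (\sum_(0 <= n < d.+1) phi_term b x y n).
  exact: eqm_le (leqnSn d) (series_eqm 0 (phi_term_eqm b x y)).
apply: eqm_trans lhs _; rewrite phi_telescope; apply: eqmD; last first.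
  by apply: eqmM => //; apply: eqm_sym; apply: (series_eqm 0 (phi_term_eqm _ _ _)).
(* The two tails starting at [q ^+ d.+1] are 1 at this precision; the finite symbols become infinite
   ones. *)
rewrite -[X in eqm _ _ X]mul1r; apply: eqmM.
  rewrite -{1}(mul1r (q ^+ d.+1)) -[X in eqm _ _ X](mulr1 1).
  exact: eqm_le (leqnSn d) (eqmM (qpoch_inf_eqm1 _ _) (qpoch_inf_eqm1 _ _)).
by apply: eqmM; apply: eqm_sym; apply: qpoch_inf_eqm.
Qed.

(** After [J] shifts the coefficient in [phi_rec] is [b q^J + x y q^(2J) = b q^J (1 + c q^J)], which
    contributes the next factor of [qpoch (- c)]. *)
Lemma phi_iter (b c x y : fps) (J : nat) : x * y = b * c ->
  phi b x y =
  \sum_(0 <= j < J) qpoch (- c) j * (b ^+ j * q ^+ (j * j.+1)%N./2) *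
     (qpoch_inf (x * q ^+ j.+1) * qpoch_inf (y * q ^+ j.+1))
  + qpoch (- c) J * (b ^+ J * q ^+ (J * J.+1)%N./2) *
     phi (b * q ^+ J) (x * q ^+ J) (y * q ^+ J).
Proof.
move=> xy; elim: J => [|J ->].
  by rewrite big_geq // qpoch0 !expr0 !mulr1 add0r mul1r.
rewrite big_nat_recr // -addrA; congr (_ + _).
rewrite phi_rec -!(mulrA _ _ q) -!exprSr qpochS.
(* The increment [J.+1] is [J] from [b * q ^+ J] plus one from the factor [q] of [phi_rec]. *)
have -> : (J.+1 * J.+2)%N./2 = ((J * J.+1)%N./2 + J.+1)%N.
  by rewrite mulnC -[J.+2]addn2 addnC mulnDl mul2n addnC halfD odd_double andbF add0n doubleK.
have -> : x * q ^+ J * (y * q ^+ J) = (b * c) * (q ^+ J * q ^+ J) by rewrite -xy; ring.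
rewrite exprD (exprS b) !(exprS q J).
by set P := phi _ _ _; set S := q ^+ _; ring.
Qed.

Lemma triangular_ge (j : nat) : (j <= (j * j.+1)./2)%N.
Proof. by case: j => // j; rewrite geq_half_double -muln2 leq_mul2l. Qed.

Lemma phi_series (b c x y : fps) : x * y = b * c ->
  phi b x y =
  fps_series_from 0 (fun j => qpoch (- c) j * (b ^+ j * q ^+ (j * j.+1)%N./2) *
     (qpoch_inf (x * q ^+ j.+1) * qpoch_inf (y * q ^+ j.+1))).
Proof.
move=> xy; set T := (fun j => _ * _); have T0 j : eqm j (T j) 0.
  have -> : T j = q ^+ (j * j.+1)%N./2 * (qpoch (- c) j * b ^+ j *
      (qpoch_inf (x * q ^+ j.+1) * qpoch_inf (y * q ^+ j.+1))).
    by rewrite /T; move: (q ^+ _./2) (qpoch_inf _) (qpoch_inf _) => *; ring.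
  exact: eqm_qX (triangular_ge j).
apply: eqmP => d; apply: eqm_trans (eqm_sym (series_eqm 0 T0)).
(* Iterating [d] times leaves a remainder divisible by a triangular power of [q], of exponent at
   least [d]. *)
rewrite (phi_iter _ _ _ _ d xy) -[X in eqm _ _ X]addr0; apply: eqmD => //.
move: (phi _ _ _) => P.
have -> : qpoch (- c) d * (b ^+ d * q ^+ (d * d.+1)%N./2) * P =
    q ^+ (d * d.+1)%N./2 * (qpoch (- c) d * b ^+ d * P).
  by move: (q ^+ _) => S; ring.
exact: eqm_qX (triangular_ge d).
Qed.

(** * Quotients of q-Pochhammer symbols and the final identity *)

(** For positive [n] the tail has constant term 1, whatever that of [a]; this allows [a = z]. *)
Lemma qpoch_inf_div (a : fps) {n : nat} : (0 < n)%N ->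
  qpoch_inf a * fps_inv (qpoch_inf (a * q ^+ n)) = qpoch a n.
Proof.
move=> n_gt0; rewrite (qpoch_inf_cat a n) -mulrA fps_mulV ?mulr1 //.
apply: qpoch_inf_coef0; rewrite fps_mul_coef0 -fps_qpowE /fps_qpow.
by case: n n_gt0 => // n _; rewrite mulr0.
Qed.

Lemma qpoch_inf_divl (a : fps) (n : nat) : a 0%N = 0 ->
  qpoch_inf a * fps_inv (qpoch a n) = qpoch_inf (a * q ^+ n).
Proof.
move=> a0; rewrite (qpoch_inf_cat a n) mulrAC fps_mulV ?mul1r //.
(* The constant term of the finite symbol divides a nonzero one, hence is nonzero. *)
have e : qpoch_inf a 0%N = qpoch a n 0%N * qpoch_inf (a * q ^+ n) 0%N.
  by rewrite -fps_mul_coef0 -qpoch_inf_cat.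
by apply: contra_neq (qpoch_inf_coef0 _ a0) => a_n0; rewrite e a_n0 mul0r.
Qed.

(* (1-z)(1-z^-1) Sbar(z,q) = sum_{n,m} (Nbar(m,n) - Mbar(m,n)) z^m q^n,
   i.e. coefficientwise in q the difference of the two generating functions *)
Theorem theorem2p1 (n : nat) :
  fps_mul (fps_c ((1 - z) * (1 - z^-1))) Sbar n = fps_sub NbarGF MbarGF n.
Proof.
pose x : fps := fps_c z; pose y : fps := fps_c z^-1.
have z0 : z != 0 by rewrite /z tofrac_eq0 polyX_eq0.
have xy : x * y = 1 * 1 by rewrite mulr1 -fps_cMm mulfV.
have m1 : fps_c (-1) = - 1 :> fps.
  by rewrite -[-1]add0r fps_cB [fps_c 0]/(0 : fps) sub0r.
have x0 : (x * q) 0%N = 0 by rewrite fps_mul_coef0 mulr0.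
have y0 : (y * q) 0%N = 0 by rewrite fps_mul_coef0 mulr0.
(* Common denominator; it has a nonzero constant term and is cancelled at the end. *)
set B := qpoch_inf (x * q) * qpoch_inf (y * q).
have B0 : B 0%N != 0 by rewrite /B fps_mul_coef0 mulf_neq0 ?qpoch_inf_coef0.
rewrite fps_cMm !fps_cB -[fps_c 1]/(1 : fps) -/x -/y.
have BN : B * NbarGF = phi 1 x y.
  have -> : NbarGF = fps_series_from 0 (fun j => q ^+ (j * j.+1)%N./2 *
      (qpoch (- 1) j * fps_inv (qpoch (x * q) j) * fps_inv (qpoch (y * q) j))).
    apply: eq_series => j _; rewrite m1 !cqE fps_qpowE !expr1 -/x -/y.
    move: (q ^+ _) (qpoch _ _) (fps_inv _) (fps_inv _) => a b c d.
    (* Conversion from [fps_mul] to the ring product, the form [ring] works on. *)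
    by rewrite -[LHS]/(b * (a * (d * c))); ring.
  rewrite (phi_series _ _ _ _ xy) mul_series => [|j]; last exact: eqm_qX (triangular_ge j).
  apply: eq_series => j _; rewrite expr1n exprS !mulrA -!qpoch_inf_divl // /B.
  by ring.
have BM : B * MbarGF = phi_term 1 x y 0.
  have -> : MbarGF = qpoch_inf (- 1 * q) * (qpoch_inf q *
      (fps_inv (qpoch_inf (x * q)) * fps_inv (qpoch_inf (y * q)))).
    by rewrite /MbarGF !cqE m1 -[fps_c 1]/(1 : fps) mul1r expr1.
  rewrite /phi_term !qpoch0 !expr1 expr0.
  have := fps_mulV (qpoch_inf_coef0 _ x0); have := fps_mulV (qpoch_inf_coef0 _ y0).
  rewrite /B; move: (qpoch_inf (x * q)) (qpoch_inf (y * q)) => X Y YV XV.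
  transitivity (qpoch_inf (- 1 * q) * qpoch_inf q * (X * fps_inv X) * (Y * fps_inv Y)).
    by ring.
  by rewrite XV YV; ring.
have BS : B * ((1 - x) * (1 - y) * Sbar) = fps_series_from 1 (phi_term 1 x y).
  (* The factors [1 - x] and [1 - y] extend [B] to symbols starting at [x] and [y]; dividing by the
     tails in [Sbar] then leaves [qpoch x n] and [qpoch y n]. *)
  have -> : B * ((1 - x) * (1 - y) * Sbar) = qpoch_inf x * qpoch_inf y * Sbar.
    by rewrite (qpoch_infS x) (qpoch_infS y) /B; ring.
  have -> : Sbar = fps_series_from 1 (fun n => q ^+ n * (qpoch_inf (- 1 * q ^+ n.+1) *
      qpoch_inf (q ^+ n.+1) * (fps_inv (qpoch_inf (x * q ^+ n)) *
                               fps_inv (qpoch_inf (y * q ^+ n))))).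
    apply: eq_series => k _; rewrite !cqE m1 fps_qpowE -/x -/y -[fps_c 1]/(1 : fps) mul1r.
    move: (q ^+ k) (qpoch_inf _) (qpoch_inf _) (fps_inv _) (fps_inv _) => a b c d e.
    by rewrite -[LHS]/(a * (c * (b * (e * d)))); ring.
  rewrite mul_series => [|k]; last exact: eqm_qX (leqnn k).
  apply: eq_series => k k_gt0; rewrite /phi_term.
  by rewrite -!(qpoch_inf_div _ k_gt0); ring.
suff -> : fps_mul ((1 - x) * (1 - y)) Sbar = NbarGF - MbarGF by [].
(* Removing the term [n = 0] (the crank part) from [phi 1 x y] (the rank part) leaves the series
   from 1. *)
apply: (fps_mulfI B0); rewrite [LHS]BS mulrBr BN BM.
by rewrite /phi series_recl addrAC subrr add0r.
Qed.
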